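(* For every integer $d\geq 1$ there exists a real constant $C_d>0$ (depending only on $d$) such that for every $d$-dimensional lattice polytope $P\subset\mathbb{R}^d$ with lattice width $\operatorname{width}(P)>C_d$, the Ehrhart $h^*$-polynomial $h^*(P;t)=\sum_{j=0}^d h_j^*(P)t^j$ has positive coefficients (that is, $h_j^*(P)>0$ for all $0\le j\le d$) and has $d$ distinct negative real roots.
   Context: A $d$-dimensional lattice polytope $P\subset\mathbb{R}^d$ is a full-dimensional convex polytope all of whose vertices lie in $\mathbb{Z}^d$. Its $h^*$-polynomial $h^*(P;t)=\sum_{j=0}^d h_j^*(P)t^j$ is the polynomial of degree at most $d$ defined by the identity of formal power series $$\sum_{n\ge 0}|nP\cap\mathbb{Z}^d|\,t^n=\frac{h^*(P;t)}{(1-t)^{d+1}},$$ where the $n=0$ term is $1$. The lattice width of a convex body $K\subset\mathbb{R}^d$ is $$\operatorname{width}(K):=\min_{0\ne u\in(\mathbb{Z}^d)^*}\left(\max_{x\in K}u(x)-\min_{x\in K}u(x)\right),$$ where $(\mathbb{Z}^d)^*$ is the set of linear functionals on $\mathbb{R}^d$ taking integer values on $\mathbb{Z}^d$. *)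

(* Defs.v *)
From HB Require Import structures.
From mathcomp Require Import all_boot all_order all_algebra finmap.
From mathcomp Require Import boolp classical_sets cardinality reals.

Set Implicit Arguments.
Unset Strict Implicit.
Unset Printing Implicit Defensive.

Import Order.TTheory GRing.Theory Num.Theory.

Local Open Scope classical_set_scope.
Local Open Scope ring_scope.

Section Polytopes.
Context {R : realType} {d : nat}.
Implicit Types (K P : set 'rV[R]_d).

Definition affine_hull K : set 'rV[R]_d :=
  [set y | exists m (x : 'I_m -> 'rV[R]_d) (c : 'I_m -> R),
     [/\ forall i, K (x i), \sum_i c i = 1 & y = \sum_i c i *: x i]].

Definition convex_hull K : set 'rV[R]_d :=
  [set y | exists m (x : 'I_m -> 'rV[R]_d) (c : 'I_m -> R),
     [/\ forall i, K (x i), forall i, 0 <= c i,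
         \sum_i c i = 1 & y = \sum_i c i *: x i]].

Definition polytope P :=
  exists2 V : set 'rV[R]_d, finite_set V & P = convex_hull V.

Definition full_dimensional K := affine_hull K = setT.

(* The vertices of a polytope are its extreme points. *)
Definition vertices P : set 'rV[R]_d :=
  [set v | P v /\ forall (x y : 'rV[R]_d) (t : R),
     P x -> P y -> 0 < t < 1 -> v = t *: x + (1 - t) *: y -> x = v /\ y = v].

Definition lattice_points : set 'rV[R]_d :=
  [set x | forall j, x 0 j \is a Num.int].

Definition lattice_polytope P :=
  [/\ polytope P, full_dimensional P & vertices P `<=` lattice_points].

Definition dilate (n : nat) K : set 'rV[R]_d := [set n%:R *: x | x in K].

(* |nP \cap Z^d|; for bounded P the set is finite, so that [fset_set] does not
   return its default value.  If P is nonempty then 0P = {0} and the value at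
   n = 0 is 1. *)
Definition ehrhart P (n : nat) : nat :=
  #|` fset_set (dilate n P `&` lattice_points)|%fset.

Definition dual_lattice (u : {linear 'rV[R]_d -> R^o}) :=
  forall x, lattice_points x -> u x \is a Num.int.

Definition width_along (u : 'rV[R]_d -> R) K : R := sup (u @` K) - inf (u @` K).

(* On a nonempty compact K, sup and inf of a functional are its max and min;
   the outer minimum over u is attained when K is a convex body. *)
Definition lattice_width K : R :=
  inf [set w | exists u : {linear 'rV[R]_d -> R^o},
         [/\ dual_lattice u, exists x, u x != 0 & w = width_along u K]].

End Polytopes.

Definition fps (R : nzRingType) := nat -> R.

Definition fps_mul (R : nzRingType) (f g : fps R) : fps R :=
  fun n => \sum_(i < n.+1) f i * g (n - i)%N.

Definition fps_poly (R : nzRingType) (p : {poly R}) : fps R := fun n => p`_n.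

Definition ehrhart_series {R : realType} {d : nat} (P : set 'rV[R]_d) : fps R :=
  fun n => (ehrhart P n)%:R.

(* h is the h*-polynomial of P: it has degree at most d, and the Ehrhart series
   is h / (1 - t)^(d+1).  Since (1 - t)^(d+1) is invertible as a power series,
   the latter is the identity Ehr_P(t) (1 - t)^(d+1) = h(t). *)
Definition is_hstar {R : realType} {d : nat} (P : set 'rV[R]_d) (h : {poly R}) :=
  (size h <= d.+1)%N /\
  fps_mul (ehrhart_series P) (fps_poly ((1 - 'X) ^+ d.+1)) =1 fps_poly h.

Lemma is_hstar_uniq {R : realType} {d : nat} (P : set 'rV[R]_d)
  (h1 h2 : {poly R}) : is_hstar P h1 -> is_hstar P h2 -> h1 = h2.
Proof.
by move=> [_ e1] [_ e2]; apply/polyP => n; have := e1 n; rewrite e2.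
Qed.

(* Main.v *)
From HB Require Import structures.
Require Import Defs.
From mathcomp Require Import all_boot all_order all_algebra finmap.
From mathcomp Require Import boolp classical_sets cardinality reals.
From mathcomp Require Import zify ring lra polyrcf.

(** A lattice polytope P of huge width looks, to the lattice, like a multiple
    of the unit cube: L(n) = |nP /\ Z^d| is close to n^d L(1) for every n <= d,
    and L(1) is huge.  Dividing by L(1), the Ehrhart series is then close to
    sum_n n^d t^n, whose numerator over (1 - t)^(d+1) is the Eulerian
    polynomial A_d(t).  So h* / L(1) is coefficientwise close to A_d.  This
    polynomial has d distinct real roots, one of them 0 and the others
    negative, hence changes sign d times; so does any nearby polynomial of
    degree at most d.  The coefficients of A_d of index 1 to d are positive and
    h*_0 = 1, so all h*_j are positive and all real roots of h* are negative
    ([near_eulerian], by interlacing of consecutive Eulerian polynomials).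

    The estimate of L(n) rests on a flatness theorem ([flatness]): if the width
    of P exceeds a constant depending on d and M only, then the translates of
    P/M by integer vectors cover R^d.  A simplex of maximal volume with a fixed
    vertex inside P reduces this to a transference bound between the covering
    radius of a lattice and its shortest dual vector ([covering]).  That bound
    is proved by induction on the rank: slice the lattice by an almost shortest
    dual vector; slices are close to one another, and the dual of the central
    slice has no short vector either, since a lift of it could be shortened by
    a multiple of the slicing vector.

    Comparing translates takes the place of volume.  Let N(m, c) be the
    number of integer points of (m/M)P + c.  Sorting the points by their
    residues modulo p expresses N(pm, c) as a sum of p^d numbers N(m, c'), and
    the covering gives N(m, c') <= N(m+1, c) for all c and c'.  Playing these
    against each other on N((M-1)(M+1), 0) shows that (M-1)^d N(M, c') is at
    most (M+1)^d N(M, c): all translates of P have about the same number of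
    integer points ([npoints_translates]), and L(n) is a sum of n^d of them
    ([ehrhart_ratio]). *)
Set Implicit Arguments.
Unset Strict Implicit.
Unset Printing Implicit Defensive.

Import Order.TTheory GRing.Theory Num.Theory.
Local Open Scope classical_set_scope.
Local Open Scope ring_scope.

(** * Sign changes and real roots *)

Section SignChanges.
Context {R : rcfType}.
Implicit Types (p q : {poly R}) (a b y : R) (s ys : seq R).

Definition sign_drop p : rel R := fun a b => (b < a) && (p.[a] * p.[b] < 0).

(** Roots from different gaps are separated by a point of [ys]. *)
Lemma roots_of_sign_drops p y ys : path (sign_drop p) y ys ->
  exists s, [/\ size s = size ys, path >%R y s & all (root p) s].
Proof.
elim: ys y => [|y1 ys IH] y /=; first by exists [::].
case/andP => /andP[lt_y1 sgn] /IH [s [sz_s path_s roots_s]].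
rewrite mulrC in sgn.
have [x] := poly_ivtoo (ltW lt_y1) sgn.
rewrite in_itv /= => /andP[y1x xy] root_x.
exists (x :: s); split; rewrite /= ?sz_s ?xy ?root_x //=.
case: s path_s {sz_s roots_s} => //= z s /andP[zy1 ->].
by rewrite andbT (lt_trans zy1).
Qed.

(** At a fixed point, the value of a polynomial of bounded degree is a
    continuous function of the coefficients. *)
Lemma sign_perturb n p a b : (size p <= n)%N -> p.[a] * p.[b] < 0 ->
  exists2 e : R, 0 < e &
  forall q, (size q <= n)%N ->
    (forall j, (j < n)%N -> `|q`_j - p`_j| <= e) -> q.[a] * q.[b] < 0.
Proof.
move=> sz_p.
pose K a : R := 1 + \sum_(j < n) `|a| ^+ j.
have K_gt0 x : 0 < K x.
  by rewrite ltr_pwDl // sumr_ge0 // => j _; rewrite exprn_ge0.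
have horner_close q e x : 0 < e -> (size q <= n)%N ->
    (forall j, (j < n)%N -> `|q`_j - p`_j| <= e) -> `|q.[x] - p.[x]| < e * K x.
  move=> e_gt0 sz_q close.
  rewrite (horner_coef_wide _ sz_p) (horner_coef_wide _ sz_q) -sumrB.
  apply: (le_lt_trans (ler_norm_sum _ _ _)).
  rewrite mulrDr mulr1 ltr_pwDl // mulr_sumr ler_sum // => j _.
  by rewrite -mulrBl normrM normrX ler_wpM2r ?exprn_ge0 // close.
have minl_le (u v : R) : Num.min u v <= u by rewrite ge_min lexx.
have minr_le (u v : R) : Num.min u v <= v by rewrite ge_min lexx orbT.
have sgn x y : p.[x] < 0 < p.[y] ->
    exists2 e : R, 0 < e & forall q, (size q <= n)%N ->
    (forall j, (j < n)%N -> `|q`_j - p`_j| <= e) -> q.[x] < 0 < q.[y].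
  case/andP=> px py; pose ex := - p.[x] / K x; pose ey := p.[y] / K y.
  have ex_gt0 : 0 < ex by rewrite divr_gt0 // oppr_gt0.
  have ey_gt0 : 0 < ey by rewrite divr_gt0.
  exists (Num.min ex ey) => [|q sz_q close]; first by rewrite lt_min ex_gt0.
  have := @horner_close q ex x ex_gt0 sz_q; rewrite divfK ?gt_eqF //.
  have := @horner_close q ey y ey_gt0 sz_q; rewrite divfK ?gt_eqF //.
  move=> /(_ (fun j jn => le_trans (close j jn) (minr_le _ _))) qy.
  move=> /(_ (fun j jn => le_trans (close j jn) (minl_le _ _))) qx.
  by move: qx qy; rewrite !ltr_norml => /andP[_ qx] /andP[qy _]; apply/andP; lra.
have [pa|pa|->] := ltrgtP p.[a] 0; last by rewrite mul0r ltxx.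
- rewrite nmulr_rlt0 // => pb; have [|e e_gt0 he] := sgn a b; first by rewrite pa.
  by exists e => // q sz_q /(he _ sz_q)/andP[qa qb]; rewrite nmulr_rlt0.
- rewrite pmulr_rlt0 // => pb; have [|e e_gt0 he] := sgn b a; first by rewrite pb.
  by exists e => // q sz_q /(he _ sz_q)/andP[qa qb]; rewrite pmulr_rlt0.
Qed.

(** This is why simple real roots survive a small change of the coefficients,
    with a tolerance that depends on the unperturbed polynomial only. *)
Lemma sign_drops_perturb n p y ys : (size p <= n)%N -> path (sign_drop p) y ys ->
  exists2 e : R, 0 < e &
  forall q, (size q <= n)%N ->
    (forall j, (j < n)%N -> `|q`_j - p`_j| <= e) -> path (sign_drop q) y ys.
Proof.
move=> sz_p; elim: ys y => [|y1 ys IH] y /=; first by exists 1.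
case/andP => /andP[lt_y1 /(sign_perturb sz_p)[e1 e1_gt0 h1]] /IH[e2 e2_gt0 h2].
exists (Num.min e1 e2) => [|q sz_q close]; first by rewrite lt_min e1_gt0.
apply/andP; split; first apply/andP; first split=> //.
  by apply: h1 => // j jn; rewrite (le_trans (close j jn)) // ge_min lexx.
by apply: h2 => // j jn; rewrite (le_trans (close j jn)) // ge_min lexx orbT.
Qed.

End SignChanges.

(** * Eulerian polynomials *)

Section Eulerian.
Context {R : rcfType}.

(** The numerator of the power series of general term n^d over (1 - X)^(d+1);
    the recursion comes from applying X d/dX to that series. *)
Fixpoint eulerian d : {poly R} :=
  if d is d'.+1 then
    d'.+1%:R *: ('X * eulerian d') + 'X * (1 - 'X) * (eulerian d')^`()
  else 1.

(** For d > 0 the Eulerian polynomial vanishes at 0; this is [eulerian d.+1]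
    without that root, so that all its roots are negative. *)
Fixpoint eulerian_red d : {poly R} :=
  if d is d'.+1 then
    (1 + d'.+1%:R *: 'X) * eulerian_red d' + 'X * (1 - 'X) * (eulerian_red d')^`()
  else 1.

Lemma eulerianS d : eulerian d.+1 = 'X * eulerian_red d.
Proof.
elim: d => [|d IH]; first by rewrite /= derivC !mulr0 addr0 scale1r mulr1.
rewrite [LHS]/= -/(eulerian d.+1) IH /= derivM derivX -!mul_polyC.
rewrite -[d.+2]addn1 natrD polyCD polyC1; ring.
Qed.

(** Modulo X^N the truncated series may replace the full one.  Multiplying the
    derivative of the identity for d by X (1 - X) gives the identity for d + 1. *)
Lemma eulerian_series d N : exists r : {poly R},
  (\poly_(i < N) i%:R ^+ d) * (1 - 'X) ^+ d.+1 = eulerian d + 'X^N * r.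
Proof.
elim: d => [|d [r IH]].
  exists (-1); rewrite /= expr1 mulrN1.
  elim: N => [|N IHN].
    by rewrite expr0 subrr poly_def big_ord0 mul0r.
  move: IHN; rewrite !poly_def big_ord_recr mulrDl => ->.
  rewrite expr0 scale1r exprS; ring.
exists (d.+1%:R *: ('X * r) + (1 - 'X) * (N%:R *: r + 'X * r^`())).
set E := \poly_(i < N) i%:R ^+ d in IH.
have -> : \poly_(i < N) i%:R ^+ d.+1 = 'X * E^`().
  apply/polyP => j; rewrite coefXM coef_poly.
  case: j => [|j]; first by rewrite expr0n if_same.
  rewrite coef_deriv coef_poly; case: ifP => _; last by rewrite mul0rn.
  by rewrite exprS mulr_natl.
have := congr1 (fun p => p^`()) IH.
rewrite derivD !derivM derivXn deriv_exp derivB derivC derivX sub0r /=.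
set F := (1 - 'X : {poly R}) in IH * => H.
have key : E^`() * F ^+ d.+1 * F =
    d.+1%:R * (E * F ^+ d.+1) + F * ((eulerian d)^`() + 'X^(N.-1) *+ N * r + 'X^N * r^`()).
  rewrite -[(eulerian d)^`() + _ + _]addrA -H.
  by rewrite [F ^+ d.+1]exprS -mulr_natl; ring.
have XN : 'X * ('X^(N.-1) *+ N) = N%:R * 'X^N :> {poly R}.
  case: (N) => [|m]; first by rewrite mulr0n mulr0 mul0r.
  by rewrite mulrnAr mulr_natl -exprS.
rewrite exprSr mulrA -[_ * F ^+ _]mulrA -[LHS]mulrA key IH -!mul_polyC.
rewrite !rmorph_nat.
have -> : 'X * (d.+1%:R * (eulerian d + 'X^N * r) + F *
   ((eulerian d)^`() + 'X^(N.-1) *+ N * r + 'X^N * r^`())) =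
   'X * (d.+1%:R * (eulerian d + 'X^N * r) + F * ((eulerian d)^`() + 'X^N * r^`()))
    + ('X * ('X^(N.-1) *+ N)) * F * r :> {poly R} by ring.
rewrite XN; ring.
Qed.


Let gtr_trans : transitive (>%R : rel R) := rev_trans lt_trans.

Lemma opp_signs n (u v : R) : (-1) ^+ n * u < 0 -> 0 < (-1) ^+ n * v -> u * v < 0.
Proof.
move=> un vn; have : (-1) ^+ n * u * ((-1) ^+ n * v) < 0 by rewrite pmulr_llt0.
by rewrite mulrACA -exprMn mulrNN mulr1 expr1n mul1r.
Qed.

Lemma sgn_horner_prod (a : R) s : all (> a) s ->
  0 < (-1) ^+ size s * (\prod_(z <- s) ('X - z%:P)).[a].
Proof.
elim: s => [|z s IH] /=; first by rewrite big_nil hornerC mul1r.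
case/andP => az /IH{}IH; rewrite big_cons hornerM hornerXsubC exprS.
have -> : forall u v : R, -1 * u * ((a - z) * v) = (z - a) * (u * v) by move=> *; ring.
by rewrite mulr_gt0 // subr_gt0.
Qed.

Lemma horner_prod_gt0 (a : R) s : all (< a) s ->
  0 < (\prod_(z <- s) ('X - z%:P)).[a].
Proof.
elim: s => [|z s IH] /=; first by rewrite big_nil hornerC.
case/andP => za /IH{}IH; rewrite big_cons hornerM hornerXsubC.
by rewrite mulr_gt0 // subr_gt0.
Qed.

(** At a simple root the derivative is the product of the other factors. *)
Lemma sgn_deriv_prod (a : R) t s : all (> a) t -> all (< a) s ->
  0 < (-1) ^+ size t * ((\prod_(z <- t ++ a :: s) ('X - z%:P))^`()).[a].
Proof.
move=> ta sa; rewrite big_cat big_cons !derivM derivXsubC.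
rewrite !(hornerXsubC, hornerM, hornerD) subrr hornerC.
rewrite !(mul0r, mul1r, mulr0, addr0, add0r) mulrA.
by rewrite mulr_gt0 ?sgn_horner_prod ?horner_prod_gt0.
Qed.

Lemma monic_sign_minfty (p : {poly R}) b : p \is monic ->
  exists2 z, z < b & 0 < (-1) ^+ (size p).-1 * p.[z].
Proof.
move=> p_monic; have p_neq0 := monic_neq0 p_monic.
pose z := Num.min (b - 1) (- cauchy_bound p).
exists z; first by rewrite gt_min ltrBlDr ltrDl ltr01.
have /(sgp_minftyP (le_cauchy_bound p_neq0)) : z \in `]-oo, - cauchy_bound p].
  by rewrite in_itv /= ge_min lexx orbT.
rewrite /sgp_minfty (monicP p_monic) mulr1 => sgz.
by rewrite -sgr_gt0 sgrM sgz -sgrM -expr2 -exprM mulnC exprM sqrrN !expr1n sgr1.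
Qed.

Lemma eulerian_red_monic d : size (eulerian_red d) = d.+1 /\ eulerian_red d \is monic.
Proof.
suff: (size (eulerian_red d) <= d.+1)%N /\ (eulerian_red d)`_d = 1.
  case=> sz lc; have sz_eq : size (eulerian_red d) = d.+1.
    apply/eqP; rewrite eqn_leq sz ltnNge; apply/negP => /leq_sizeP/(_ d (leqnn d)).
    by rewrite lc => /eqP; rewrite oner_eq0.
  by rewrite monicE lead_coefE sz_eq lc.
elim: d => [|d [sz lc]]; first by rewrite /= size_poly1 coef1.
have big j : (d < j)%N -> (eulerian_red d)`_j = 0.
  by move=> dj; apply/(leq_sizeP _ _ sz).
have coefS j : (eulerian_red d.+1)`_j.+1 =
   (eulerian_red d)`_j.+1 *+ j.+2 + (d.+1%:R - j%:R) * (eulerian_red d)`_j.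
  rewrite /= mulrDl mul1r -scalerAl -mulrA mulrBl mul1r mulrBr.
  rewrite !(coefD, coefB, coefN, coefZ, coefXM, coef_deriv) /=.
  case: j => [|j] /=.
    by rewrite mulrS !mulr1n; ring.
  rewrite mulrBl [_ *+ j.+3]mulrS [j.+1%:R * _]mulr_natl; ring.
split; last first.
  by rewrite coefS big // mul0rn add0r lc mulr1 -natrB // subSnn.
by apply/leq_sizeP => -[//|j] dj; rewrite coefS !big ?(ltnW dj) // mul0rn mulr0 addr0.
Qed.

Lemma eulerian_red0 d : (eulerian_red d).[0] = 1.
Proof.
elim: d => [|d IH]; first by rewrite hornerC.
by rewrite /= hornerD !hornerM hornerX !mul0r addr0 hornerD hornerZ hornerX mulr0 addr0
           hornerC IH mulr1.
Qed.

(** Interlacing: at a root a < 0 of the previous polynomial p, the next one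
    takes the value a (1 - a) p'(a), and the signs of p' alternate along the
    roots of p.  Together with the value 1 at 0 and the sign at -oo this makes
    one more sign change than p has roots. *)
Lemma eulerian_red_roots d : exists s,
  [/\ size s = d, path >%R 0 s & eulerian_red d = \prod_(z <- s) ('X - z%:P)].
Proof.
elim: d => [|d [s [sz_s path_s def_p]]]; first by exists [::]; rewrite big_nil.
have [sz_T T_monic] := eulerian_red_monic d.+1.
have T0 := eulerian_red0 d.+1.
set T := eulerian_red d.+1 in sz_T T_monic T0 *.
have T_root a : root (eulerian_red d) a -> T.[a] = a * (1 - a) * (eulerian_red d)^`().[a].
  move=> /rootP pa; rewrite /T /= hornerD !hornerM pa mulr0 add0r.
  by rewrite hornerX hornerD hornerN hornerX hornerC.
have [z] := monic_sign_minfty (last 0 s) T_monic; rewrite sz_T /= => lt_z sgn_z.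
have T_alt t a r : s = t ++ a :: r -> (-1) ^+ size t * T.[a] < 0.
  move=> def_s; have /= := path_s; rewrite (path_sortedE gtr_trans).
  case/andP=> /allP s_lt0 s_sorted.
  have a_lt0 : a < 0 by apply: s_lt0; rewrite def_s mem_cat inE eqxx orbT.
  move: s_sorted; rewrite def_s (sorted_pairwise gtr_trans) pairwise_cat.
  case/and3P=> /allrelP ta _ /= /andP[ar _].
  rewrite T_root; last first.
    by rewrite def_p def_s root_prod_XsubC mem_cat inE eqxx orbT.
  have /sgn_deriv_prod/(_ ar) : all (> a) t.
    by apply/allP => x xt; apply: ta; rewrite // inE eqxx.
  rewrite -def_s -def_p => sgn.
  rewrite mulrCA nmulr_rlt0 // nmulr_rlt0 //; lra.
suff alt : path (sign_drop T) 0 (rcons s z).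
  have [r [sz_r path_r roots_r]] := roots_of_sign_drops alt.
  rewrite size_rcons sz_s in sz_r.
  exists r; split=> //.
  rewrite [LHS](@all_roots_prod_XsubC _ _ r) ?sz_r //.
    by rewrite (monicP T_monic) scale1r.
  by rewrite uniq_rootsE (sorted_uniq gtr_trans (@ltxx _ _)) // (path_sorted path_r).
have next t a r : s = t ++ a :: r -> path >%R a r -> path (sign_drop T) a (rcons r z).
  elim: r t a => [|b r IH] t a def_s /= => [_|/andP[ba path_r]].
    rewrite def_s last_cat /= in lt_z; rewrite /sign_drop lt_z /= andbT.
    apply: (opp_signs (T_alt t a [::] def_s)).
    by rewrite -sz_s def_s size_cat addn1 !exprS mulrA mulrNN mul1r mul1r in sgn_z.
  apply/andP; split; last by apply: (IH (rcons t a)); rewrite ?cat_rcons.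
  rewrite /sign_drop ba /=; apply: (opp_signs (T_alt _ _ _ def_s)).
  have := T_alt (rcons t a) b r; rewrite cat_rcons size_rcons exprS => /(_ def_s).
  by rewrite mulN1r mulNr oppr_lt0.
case def_s : s path_s => [|a r] /=.
  move=> _; rewrite def_s /= in lt_z sz_s; rewrite /sign_drop lt_z T0 mul1r andbT /=.
  by move: sgn_z; rewrite -sz_s expr1 mulN1r oppr_gt0.
case/andP=> a_lt0 path_r; apply/andP; split; last exact: (next [::]).
rewrite /sign_drop a_lt0 T0 mul1r /=.
by have := T_alt [::] a r def_s; rewrite mul1r.
Qed.

(** Points chosen between consecutive roots witness the sign changes. *)
Lemma sign_drops_prod (y : R) s : path >%R y s ->
  exists2 ys, size ys = size s &
    path (sign_drop (\prod_(z <- s) ('X - z%:P))) y ys.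
Proof.
have sgn (t r : seq R) (b : R) : all (> b) t -> all (< b) r ->
    0 < (-1) ^+ size t * (\prod_(z <- t ++ r) ('X - z%:P)).[b].
  move=> tb rb; rewrite big_cat hornerM mulrA.
  by apply: mulr_gt0; [apply: sgn_horner_prod | apply: horner_prod_gt0].
(* t collects the roots already passed, which determine the sign at b *)
suff main t b : all (> b) t -> path >%R b s -> exists2 ys, size ys = size s &
    path (sign_drop (\prod_(z <- t ++ s) ('X - z%:P))) b ys.
  exact: (main [::] y isT).
elim: s t b => [|a s IH] t b tb /=; first by exists [::].
case/andP=> ab path_s.
have [b1 b1a s_b1] : exists2 b1, b1 < a & path >%R b1 s.
  case: s path_s {IH} => [_|c s /= /andP[ca ->]].
    by exists (a - 1); rewrite // ltrBlDr ltrDl.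
  by exists ((a + c) / 2%:R); [lra | rewrite andbT; lra].
have b1b := lt_trans b1a ab.
have tb1 : all (> b1) (rcons t a).
  by rewrite all_rcons b1a; apply: sub_all tb => x; apply: lt_trans.
have [ys sz_ys path_ys] := IH (rcons t a) b1 tb1 s_b1.
rewrite cat_rcons in path_ys; exists (b1 :: ys); rewrite /= ?sz_ys //.
apply/andP; split=> //; rewrite /sign_drop b1b /=.
have s_lt c : path >%R c s -> all (< c) s.
  by rewrite (path_sortedE gtr_trans) => /andP[].
rewrite mulrC; apply: (@opp_signs (size t)).
  have := sgn (rcons t a) s b1 tb1 (s_lt _ s_b1).
  by rewrite cat_rcons size_rcons exprS mulN1r mulNr oppr_gt0.
apply: sgn => //=; rewrite ab; apply: sub_all (s_lt _ path_s) => x xa.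
exact: lt_trans xa ab.
Qed.

Lemma prod_XsubC_coef_gt0 (s : seq R) : all (< 0) s ->
  forall j, (j <= size s)%N -> 0 < (\prod_(z <- s) ('X - z%:P) : {poly R})`_j.
Proof.
elim: s => [_ [|//] _|z s IH /= /andP[z_lt0 /IH{}IH] j]; first by rewrite big_nil coef1.
have pos k : 0 <= (\prod_(z <- s) ('X - z%:P) : {poly R})`_k.
  have [/IH/ltW //|sk] := leqP k (size s).
  by rewrite nth_default // size_prod_XsubC.
rewrite big_cons mulrBl coefB coefXM mul_polyC coefZ -mulNr.
case: j => [_|j js]; first by rewrite add0r mulr_gt0 ?oppr_gt0 ?IH.
by rewrite ltr_pwDl ?IH // mulr_ge0 // oppr_ge0 ltW.
Qed.

Lemma fin_lower_bound n (f : nat -> R) : (forall j, (j < n)%N -> 0 < f j) ->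
  exists2 e : R, 0 < e & forall j, (j < n)%N -> e <= f j.
Proof.
elim: n => [|n IH] f_gt0; first by exists 1.
have [|e e_gt0 he] := IH; first by move=> j jn; rewrite f_gt0 // ltnW.
exists (Num.min e (f n)); first by rewrite lt_min e_gt0 f_gt0.
move=> j; rewrite ltnS leq_eqVlt => /predU1P[->|/he ej]; rewrite ge_min ?lexx ?orbT //.
by rewrite ej.
Qed.

(** The root 0 of the Eulerian polynomial moves to the negative side because
    all coefficients of q, including the constant one, are positive. *)
Lemma near_eulerian d : exists2 e : R, 0 < e &
  forall q : {poly R}, (size q <= d.+2)%N -> 0 < q`_0 ->
  (forall j, (j <= d.+1)%N -> `|q`_j - (eulerian d.+1)`_j| <= e) ->
  (forall j, (j <= d.+1)%N -> 0 < q`_j) /\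
  exists s : seq R, [/\ size s = d.+1, uniq s & forall x, x \in s -> x < 0 /\ root q x].
Proof.
have [s [sz_s path_s def_p]] := eulerian_red_roots d.
have def_E : eulerian d.+1 = \prod_(z <- 0 :: s) ('X - z%:P).
  by rewrite eulerianS def_p big_cons subr0.
have path_s1 : path >%R 1 (0 :: s) by rewrite /= ltr01.
have [ys sz_ys] := sign_drops_prod path_s1.
rewrite -def_E => /(@sign_drops_perturb _ d.+2) [|e1 e1_gt0 close].
  by rewrite def_E size_prod_XsubC /= sz_s.
have s_lt0 : all (< 0) s by move: path_s; rewrite (path_sortedE gtr_trans) => /andP[].
have [|e2 e2_gt0 he2] := @fin_lower_bound d.+1 (fun j => (eulerian_red d)`_j).
  by move=> j jd; rewrite def_p prod_XsubC_coef_gt0 // sz_s.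
exists (Num.min e1 (e2 / 2%:R)) => [|q sz_q q0 close_q].
  by rewrite lt_min e1_gt0 divr_gt0.
have q_gt0 j : (j <= d.+1)%N -> 0 < q`_j.
  case: j => // j jd; have := close_q _ jd; rewrite le_min => /andP[_].
  rewrite eulerianS coefXM /= => /ler_normlP[h _]; have := he2 j jd; lra.
split=> //; have [|r [sz_r path_r roots_r]] := roots_of_sign_drops (close q sz_q _).
  by move=> j jd; have := close_q j jd; rewrite le_min => /andP[].
exists r; split; first by rewrite sz_r sz_ys /= sz_s.
  by rewrite (sorted_uniq gtr_trans (@ltxx _ _)) // (path_sorted path_r).
move=> x /(allP roots_r) qx; split=> //; rewrite ltNge; apply/negP => x_ge0.
move/rootP: qx; apply/eqP; rewrite gt_eqF // (horner_coef_wide _ sz_q) big_ord_recl /=.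
rewrite expr0 mulr1 ltr_pwDl // sumr_ge0 // => j _.
by rewrite mulr_ge0 ?exprn_ge0 // ltW // q_gt0 // lift0 ltn_ord.
Qed.

End Eulerian.

(** * Covering radius versus shortest dual vectors *)

Section Covering.
Context {R : realType}.

(** The Euclidean inner product is used because orthogonal decompositions then
    replace norm inequalities. *)
Definition dot n (x y : 'rV[R]_n) : R := (x *m y^T) 0 0.
Definition int_row n (x : 'rV[R]_n) : bool := [forall i, x 0 i \is a Num.int].
Definition imx m n (z : 'M[int]_(m, n)) : 'M[R]_(m, n) := map_mx intr z.

Section Dot.
Context {n : nat}.
Implicit Types x y z : 'rV[R]_n.

Lemma dotC x y : dot x y = dot y x.
Proof. by rewrite /dot -[x *m y^T]trmxK trmx_mul trmxK mxE. Qed.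
Lemma dotDl x y z : dot (x + y) z = dot x z + dot y z.
Proof. by rewrite /dot mulmxDl mxE. Qed.
Lemma dotZl a x y : dot (a *: x) y = a * dot x y.
Proof. by rewrite /dot -scalemxAl mxE. Qed.
Lemma dotDr x y z : dot z (x + y) = dot z x + dot z y.
Proof. by rewrite dotC dotDl !(dotC _ z). Qed.
Lemma dotZr a x y : dot y (a *: x) = a * dot y x.
Proof. by rewrite dotC dotZl dotC. Qed.
Lemma dotNl x y : dot (- x) y = - dot x y.
Proof. by rewrite -scaleN1r dotZl mulN1r. Qed.
Lemma dot0l x : dot 0 x = 0.
Proof. by rewrite /dot mul0mx mxE. Qed.

Lemma dotE x y : dot x y = \sum_i x 0 i * y 0 i.
Proof. by rewrite /dot mxE; apply: eq_bigr => i _; rewrite mxE. Qed.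
Lemma dot_ge0 x : 0 <= dot x x.
Proof. by rewrite dotE sumr_ge0 // => i _; rewrite -expr2 sqr_ge0. Qed.
Lemma dot_eq0 x : dot x x = 0 -> x = 0.
Proof.
rewrite dotE => /eqP; rewrite psumr_eq0; last by move=> i _; rewrite -expr2 sqr_ge0.
move=> /allP x0; apply/rowP => i; rewrite mxE.
by have := x0 i (mem_index_enum i); rewrite /= -expr2 sqrf_eq0 => /eqP.
Qed.
Lemma dot_gt0 x : x != 0 -> 0 < dot x x.
Proof. by move=> x0; rewrite lt_def dot_ge0 andbT; apply: contraNneq x0 => /dot_eq0 ->. Qed.
Lemma coord_le_dot x i : x 0 i ^+ 2 <= dot x x.
Proof.
rewrite dotE (bigD1 i) //= expr2 lerDl sumr_ge0 // => j _.
by rewrite -expr2 sqr_ge0.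
Qed.
Lemma pythagoras x y a : dot x y = 0 ->
  dot (x + a *: y) (x + a *: y) = dot x x + a ^+ 2 * dot y y.
Proof. by move=> xy; rewrite dotDl !dotDr !dotZl !dotZr (dotC y) xy; ring. Qed.

End Dot.

Lemma gram_unit m n (A : 'M[R]_(m, n)) : row_free A -> A *m A^T \in unitmx.
Proof.
move=> freeA; rewrite -row_free_unit; apply: inj_row_free => v vG.
have : dot (v *m A) (v *m A) = 0.
  by rewrite /dot trmx_mul mulmxA -[v *m A *m _]mulmxA vG mul0mx mxE.
by move/dot_eq0 => vA; apply: (row_free_inj freeA); rewrite vA mul0mx.
Qed.

(** The bound 1/4 is the square of the distance 1/2 to a nearest integer. *)
Lemma near_int (t : R) : exists k : int, (t - k%:~R) ^+ 2 <= 4%:R^-1.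
Proof.
exists (Num.floor (t + 2%:R^-1)).
have := floor_itv (t + 2%:R^-1); set k := Num.floor _.
rewrite intrD => /andP[h1 h2]; nra.
Qed.

(** For f in the row space of A, this is membership in the dual of the lattice
    spanned by the rows of A. *)
Definition integral_on m n (A : 'M[R]_(m, n)) (f : 'rV[R]_n) := int_row (f *m A^T).

Lemma int_rowP n (x : 'rV[R]_n) : reflect (exists z, x = imx z) (int_row x).
Proof.
apply: (iffP forallP) => [xi|[z ->] i]; last by rewrite mxE intr_int.
exists (\row_i Num.floor (x 0 i)); apply/rowP => i; rewrite !mxE.
by have /intrP[k ->] := xi i; rewrite floorK ?intr_int.
Qed.

Lemma imxM m n p (x : 'M[int]_(m, n)) (y : 'M[int]_(n, p)) :
  imx (x *m y) = imx x *m imx y.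
Proof. exact: map_mxM. Qed.

(** The Smith normal form of a single row; [U] serves to change the basis of a
    lattice so that a given dual vector vanishes on all basis vectors but one. *)
Lemma int_row_reduce n (z : 'rV[int]_(1 + n)) :
  exists2 U : 'M[int]_(1 + n), U \in unitmx &
  exists m : int, z *m U = row_mx m%:M 0.
Proof.
have [L L_unit [V V_unit [s _ def_z]]] := int_Smith_normal_form z.
exists (invmx V); first by rewrite unitmx_inv.
exists (L 0 0 * s`_0); rewrite def_z mulmxK //; apply/rowP => j.
rewrite !mxE big_ord1 !mxE; case: splitP => k jk; rewrite mxE.
  by rewrite (ord1 k) in jk *; rewrite jk eqxx !mulr1n.
by rewrite jk /= mulr0n mulr0.
Qed.

(** The factor 2 makes this a statement about the infimum of the squared lengths,
    which is positive, instead of a minimum. *)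
Lemma near_shortest n (S : set 'rV[R]_n) c : 0 < c -> (exists f, S f) ->
  (forall f, S f -> c <= dot f f) ->
  exists2 f, S f & forall g, S g -> dot f f <= 2%:R * dot g g.
Proof.
move=> c_gt0 [f0 Sf0] S_ge; pose E := [set dot f f | f in S]%classic.
have E_ge : lbound E c by move=> _ [f Sf <-]; apply: S_ge.
have E0 : (E !=set0)%classic by exists (dot f0 f0), f0.
have inf_gt0 : 0 < inf E by apply: lt_le_trans c_gt0 (lb_le_inf E0 E_ge).
have [|_ [f Sf <-] f_lt] := inf_adherent inf_gt0 (conj E0 _); first by exists c.
exists f => // g Sg.
have : inf E <= dot g g by apply: ge_inf; [exists c | exists g].
lra.
Qed.

(** The transference bound: a lattice without short dual vectors has a small
    covering radius.  Let e be an almost shortest dual vector, with value 1 on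
    the basis vector a and 0 on the other basis vectors A'.
    - If f is dual to the lattice A', then adding to f a multiple s e with
      s^2 <= 1/4 makes it dual to the whole lattice, so that
      |e|^2 <= 2 (|f|^2 + |e|^2 / 4) and |f|^2 >= |e|^2 / 4 >= c / 4.
    - A point x is at distance at most 1 / (2 |e|) from a slice on which e takes
      an integer value, and the induction hypothesis applies in that slice.
    The two displacements are orthogonal, so the squared bounds add up to at
    most (4 * 9^d + 1/4) / c. *)
Lemma covering n d (A : 'M[R]_(d, n)) c : 0 < c -> row_free A ->
  (forall f, (f <= A)%MS -> f != 0 -> integral_on A f -> c <= dot f f) ->
  forall x, (x <= A)%MS ->
    exists z : 'rV[int]_d, dot (x - imx z *m A) (x - imx z *m A) <= 9%:R ^+ d / c.
Proof.
elim: d A c => [|d IH] A c c_gt0 freeA dual_ge x xA.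
  exists 0; have -> : x - imx 0 *m A = 0.
    by rewrite (flatmx0 A) in xA *; rewrite (submx0null xA) mulmx0 subr0.
  by rewrite dot0l divr_ge0 ?exprn_ge0 ?ltW.
pose S := [set f : 'rV[R]_n | [/\ (f <= A)%MS, f != 0 & integral_on A f]]%classic.
have S_ge f : S f -> c <= dot f f by case; apply: dual_ge.
have S0 : exists f, S f.
  pose f : 'rV[R]_n := delta_mx 0 0 *m invmx (A *m A^T) *m A.
  have fA : f *m A^T = delta_mx 0 0.
    by rewrite /f -[_ *m A *m _]mulmxA mulmxKV ?gram_unit.
  exists f; split; first by rewrite submxMl.
    apply/eqP => f0; move: fA; rewrite f0 mul0mx => /matrixP/(_ 0 0)/eqP.
    by rewrite !mxE !eqxx eq_sym oner_eq0.
  by apply/forallP => i; rewrite fA mxE natr_int.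
have [f [fA f0 /int_rowP[z def_z]] f_min] := near_shortest c_gt0 S0 S_ge.
have {S0} f_gt0 := dot_gt0 f0.
have [U U_unit [m zU]] := @int_row_reduce d z.
pose A1 : 'M[R]_(1 + d, n) := (imx U)^T *m A.
have UV : imx U *m imx (invmx U) = 1%:M by rewrite -imxM mulmxV // /imx map_mx1.
have [U_unitR _] := mulmx1_unit UV.
have defA : A = (imx (invmx U))^T *m A1.
  by rewrite mulmxA -trmx_mul UV trmx1 mul1mx.
have eqA : (A1 :=: A)%MS by apply: eqmxMfull; rewrite row_full_unit unitmx_tr.
have integral_A g : integral_on A1 g -> integral_on A g.
  move=> /int_rowP[w gw]; apply/int_rowP; exists (w *m invmx U).
  by rewrite {1}defA trmx_mul trmxK mulmxA gw imxM.
have fA1 : f *m A1^T = row_mx m%:~R%:M 0.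
  by rewrite trmx_mul trmxK mulmxA def_z -imxM zU /imx map_row_mx map_scalar_mx map_mx0.
(* dividing f by m keeps it in the dual lattice and shortens it *)
have m_neq0 : m != 0.
  apply: contraNneq f0 => m0; rewrite -eqA in fA; case/submxP: fA => w fw.
  apply/eqP/dot_eq0; rewrite /dot {2}fw trmx_mul mulmxA fA1 m0.
  by rewrite raddf0 row_mx0 mul0mx mxE.
have mR_neq0 : m%:~R != 0 :> R by rewrite intr_eq0.
pose e := m%:~R^-1 *: f.
have eA1 : e *m A1^T = row_mx 1%:M 0.
  by rewrite -scalemxAl fA1 scale_row_mx scaler0 scale_scalar_mx mulVf.
have eA : (e <= A)%MS by apply: scalemx_sub.
have e_neq0 : e != 0 by rewrite scaler_eq0 invr_eq0 negb_or mR_neq0.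
have e_gt0 := dot_gt0 e_neq0.
have e_min g : (g <= A)%MS -> g != 0 -> integral_on A g -> dot e e <= 2%:R * dot g g.
  move=> gA g0 gi; apply: (le_trans _ (f_min g _)) => //.
  rewrite dotZl dotZr mulrA ler_piMl ?(ltW f_gt0) // -invfM -expr2.
  have m2 : 1 <= m%:~R ^+ 2 :> R.
    by rewrite -rmorphXn /= ler1z -gtz0_ge1 exprn_even_gt0 //= orbC.
  by rewrite invf_le1 // (lt_le_trans ltr01).
have e_int : integral_on A e.
  apply/integral_A/int_rowP; exists (row_mx 1%:M 0).
  by rewrite eA1 /imx map_row_mx map_mx1 map_mx0.
have e_ge : c <= dot e e by apply: dual_ge.
clearbody e; clear f_min f_gt0 m_neq0 mR_neq0 fA1 zU def_z fA f0 f z m.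
pose a := usubmx A1; pose A' := dsubmx A1.
have A1E : A1 = col_mx a A' by rewrite vsubmxK.
have [ea eA'] : e *m a^T = 1%:M /\ e *m A'^T = 0.
  by apply: eq_row_mx; rewrite -mul_mx_row -tr_col_mx -A1E.
have freeA' : row_free A'.
  have freeA1 : row_free A1 by rewrite /row_free eqA.
  apply: inj_row_free => v vA'; have : row_mx 0 v *m A1 = 0.
    by rewrite A1E mul_row_col mul0mx vA' addr0.
  by move/(canRL (mulmxKp freeA1)); rewrite mul0mx -row_mx0 => /eq_row_mx[].
have orthA' y : (y <= A')%MS -> dot y e = 0.
  by case/submxP=> w ->; rewrite dotC /dot trmx_mul mulmxA eA' mul0mx mxE.
have A'A : (A' <= A)%MS by rewrite -eqA A1E -addsmxE addsmxSr.
have dual' f : (f <= A')%MS -> f != 0 -> integral_on A' f -> c / 4%:R <= dot f f.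
  move=> fA' f0 f_int.
  have [k near_k] := near_int (dot f a).
  (* g is a lift of f to the dual of the whole lattice *)
  pose g := f + (k%:~R - dot f a) *: e.
  have gf : dot g f = dot f f by rewrite dotDl dotZl (dotC e) orthA' // mulr0 addr0.
  have g0 : g != 0.
    by apply: contraTneq (dot_gt0 f0) => g0; rewrite -gf g0 dot0l ltxx.
  have gA : (g <= A)%MS by rewrite addmx_sub ?scalemx_sub // (submx_trans fA').
  have gi : integral_on A g.
    have /int_rowP[w fw] := f_int.
    apply/integral_A/int_rowP; exists (row_mx k%:M w).
    rewrite A1E tr_col_mx mul_mx_row mulmxDl -scalemxAl ea mulmxDl.
    rewrite -scalemxAl eA' scaler0 addr0 fw.
    rewrite /imx map_row_mx map_scalar_mx; congr row_mx.
    apply/matrixP => i j; rewrite (ord1 i) (ord1 j) !mxE !mulr1n mulr1 -/(dot f a).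
    by rewrite [dot _ _]mxE addrC subrK.
  have := e_min g gA g0 gi; rewrite /g pythagoras; last exact: orthA'.
  rewrite -sqrrN opprB.
  have := ler_wpM2r (ltW e_gt0) near_k; lra.
pose t := dot x e; have [k near_k] := near_int t.
(* y is x projected along e to the slice of value k, which is then shifted
   by k a to the slice of value 0, the row space of A' *)
pose s := (t - k%:~R) / dot e e; pose y := x - k%:~R *: a - s *: e.
have ae : dot a e = 1 by rewrite dotC /dot ea mxE.
have ye : dot y e = 0.
  rewrite !dotDl !dotNl !dotZl ae mulr1 -/t divfK ?gt_eqF //; ring.
have aA : (a <= A)%MS by rewrite -eqA A1E -addsmxE addsmxSl.
have yA' : (y <= A')%MS.
  have : (y <= A1)%MS by rewrite eqA !addmx_sub ?eqmx_opp ?scalemx_sub.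
  case/submxP=> w def_y; move: ye; rewrite {1}def_y /dot -mulmxA A1E mul_col_mx.
  rewrite -[a *m e^T]trmxK trmx_mul trmxK ea -[A' *m e^T]trmxK trmx_mul trmxK eA'.
  rewrite trmx1 trmx0 -[w]hsubmxK mul_row_col mulmx1 mulmx0 addr0 => w0.
  rewrite def_y -[w]hsubmxK A1E mul_row_col.
  have -> : lsubmx w = 0 by apply/matrixP => i j; rewrite (ord1 i) (ord1 j) w0 mxE.
  by rewrite mul0mx add0r submxMl.
have [|z' hz'] := IH A' (c / 4%:R) _ freeA' dual' y yA'; first by rewrite divr_gt0.
exists (row_mx k%:M z' *m U^T).
have -> : x - imx (row_mx k%:M z' *m U^T) *m A = (y - imx z' *m A') + s *: e.
  have -> : imx (row_mx k%:M z' *m U^T) *m A = k%:~R *: a + imx z' *m A'.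
    rewrite imxM {2}/imx -map_trmx -/(imx U) -mulmxA -/A1 A1E.
    by rewrite /imx map_row_mx map_scalar_mx mul_row_col mul_scalar_mx.
  by rewrite /y opprD addrA [RHS]addrAC subrK.
rewrite pythagoras; last by rewrite orthA' // addmx_sub // eqmx_opp submxMl.
have : s ^+ 2 * dot e e <= 4%:R^-1 / c.
  have -> : s ^+ 2 * dot e e = (t - k%:~R) ^+ 2 / dot e e.
    by rewrite /s; field; rewrite gt_eqF.
  apply: ler_pM => //; [exact: sqr_ge0 | by rewrite invr_ge0 ltW |].
  by rewrite lef_pV2 // posrE.
rewrite invfM invrK (mulrA _ _ 4%:R) in hz'.
have : 1 <= 9%:R ^+ d :> R by rewrite exprn_ege1 // ler1n.
have : 0 < c^-1 by rewrite invr_gt0.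
rewrite [9%:R ^+ d.+1]exprS; move: (9%:R ^+ d) (c^-1) hz' => N C hz' C0 N1 hs.
have := ler_wpM2r (ltW C0) N1; lra.
Qed.

End Covering.

(** * Wide polytopes cover space modulo the lattice *)

Section Geometry.
Context {R : realType} {d : nat}.

Definition stochastic N (c : 'rV[R]_N) := (forall i, 0 <= c 0 i) /\ \sum_i c 0 i = 1.

Definition hull_rows N (S : 'M[R]_(N, d)) : set 'rV[R]_d :=
  [set p | exists2 c, stochastic c & p = c *m S].

Lemma polytope_rows (P : set 'rV[R]_d) : polytope P ->
  exists N (S : 'M[R]_(N, d)), P = hull_rows S.
Proof.
case=> V /finite_seqP[s ->] ->.
exists (size s), (\matrix_(i < size s) s`_i); apply/seteqP; split=> p.
  case=> m [x [c [xs c_ge0 c1 ->]]].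
  have idx i : exists j : 'I_(size s), x i = s`_j.
    have /= xi := xs i; exists (Ordinal (etrans (index_mem _ _) xi)).
    by rewrite /= nth_index.
  have [g xg] := choice idx.
  exists (\row_j \sum_(i | g i == j) c i).
    split=> [j|]; first by rewrite mxE sumr_ge0.
    by rewrite -c1 [RHS](partition_big g xpredT) //; apply: eq_bigr => j _; rewrite mxE.
  rewrite mulmx_sum_row (partition_big g xpredT) //=; apply: eq_bigr => j _.
  by rewrite mxE scaler_suml rowK; apply: eq_bigr => i /eqP <-; rewrite xg.
case=> c [c_ge0 c1] ->; exists (size s), (fun i => s`_i), (fun i => c 0 i); split=> //.
  by move=> i /=; rewrite mem_nth.
by rewrite mulmx_sum_row; apply: eq_bigr => i _; rewrite rowK.
Qed.

(** Choose d rows with |det| maximal.  By Cramer's rule a coordinate of another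
    row is the ratio of the determinant after an exchange of rows to this
    maximal determinant. *)
Lemma max_minor N (D : 'M[R]_(N, d)) : row_full D ->
  exists2 f : 'I_d -> 'I_N, rowsub f D \in unitmx &
    forall i j, `|(D *m invmx (rowsub f D)) i j| <= 1.
Proof.
move=> fullD; pose F (f : {ffun 'I_d -> 'I_N}) := `|\det (rowsub f D)|.
pose f0 : {ffun 'I_d -> 'I_N} := [ffun i => fullrankfun fullD i].
have F0 : 0 < F f0.
  rewrite normr_gt0 -unitfE -unitmxE; have -> : rowsub f0 D = rowsub (fullrankfun fullD) D.
    by apply/matrixP => i j; rewrite !mxE ffunE.
  exact: fullrowsub_unit.
case: (@Order.TotalTheory.arg_maxP _ _ _ f0 xpredT F isT) => f _ f_max.
have unitE : rowsub f D \in unitmx.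
  by rewrite unitmxE unitfE -normr_gt0; apply: lt_le_trans F0 (f_max f0 isT).
exists f => // i j; set E := rowsub f D.
have -> : (D *m invmx E) i j = \det (rowsub (fun k => if k == j then i else f k) D) / \det E.
  rewrite (expand_det_row _ j) /invmx unitE mxE mulr_suml; apply: eq_bigr => k _.
  rewrite !mxE eqxx [_ / _]mulrC mulrCA; congr (_ * (_ * _)).
  rewrite /cofactor; congr (_ * \det _); apply/matrixP => a b.
  by rewrite !mxE eq_sym (negbTE (neq_lift _ _)).
rewrite normrM normfV ler_pdivrMr ?normr_gt0 -?unitfE -?unitmxE // mul1r.
have := f_max [ffun k => if k == j then i else f k] isT; rewrite /F.
by congr (`|\det _| <= _); apply/matrixP => a b; rewrite !mxE ffunE.
Qed.

Lemma full_dimensional_rows N (S : 'M[R]_(N, d)) : full_dimensional (hull_rows S) ->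
  exists i0 : 'I_N, row_full (\matrix_i (row i S - row i0 S)).
Proof.
move=> full.
have [i0 _] : exists i : 'I_N, True.
  have : affine_hull (hull_rows S) 0 by rewrite full.
  case=> -[|m] [x [c [xS c1 _]]]; first by move/eqP: c1; rewrite big_ord0 eq_sym oner_eq0.
  have [e [_ e1] _] := xS ord0; case: N S e e1 {full x xS} => [|N] S e e1; last by exists ord0.
  by move/eqP: e1; rewrite big_ord0 eq_sym oner_eq0.
exists i0; set D := \matrix_i _.
have hull_D p : hull_rows S p -> (p - row i0 S <= D)%MS.
  case=> c [_ c1] ->; apply/submxP; exists c.
  have -> : D = S - const_mx 1 *m row i0 S.
    by apply/matrixP => i j; rewrite !mxE big_ord1 !mxE mul1r.
  rewrite mulmxBr mulmxA; have -> : c *m const_mx 1 = 1%:M :> 'M_1.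
    apply/rowP => j; rewrite (ord1 j) !mxE eqxx -[RHS]c1.
    by apply: eq_bigr => i _; rewrite mxE mulr1.
  by rewrite mul1mx.
rewrite -sub1mx; apply/row_subP => i; set x := row i _.
have : affine_hull (hull_rows S) (x + row i0 S) by rewrite full.
case=> m [y [c [yS c1 def_x]]].
have -> : x = \sum_i c i *: (y i - row i0 S).
  under eq_bigr do rewrite scalerBr.
  by rewrite sumrB -def_x -scaler_suml c1 scale1r addrK.
by apply: summx_sub => k _; rewrite scalemx_sub // hull_D.
Qed.

Definition convex_set (K : set 'rV[R]_d) := forall p q t, K p -> K q -> 0 <= t <= 1 ->
  K (t *: p + (1 - t) *: q).

Lemma convex_hull_rows N (S : 'M[R]_(N, d)) : convex_set (hull_rows S).
Proof.
move=> _ _ t [b [b_ge0 b1] ->] [c [c_ge0 c1] ->] /andP[t_ge0 t_le1].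
exists (t *: b + (1 - t) *: c); last by rewrite mulmxDl -!scalemxAl.
split=> [i|]; first by rewrite !mxE addr_ge0 ?mulr_ge0 // subr_ge0.
under eq_bigr do rewrite !mxE.
by rewrite big_split -!mulr_sumr b1 c1 /= !mulr1 addrC subrK.
Qed.

(** The simplex with vertex v and edges the rows of E is one of largest volume
    among those with vertex v spanned by the points that generate P; by
    maximality P lies in the parallelepiped v + [-1, 1]^d E.  This replaces the
    John ellipsoid. *)
Lemma simplex_sandwich P : polytope P -> full_dimensional P ->
  exists (v : 'rV[R]_d) (E : 'M[R]_d), [/\ convex_set P, E \in unitmx,
    forall w : 'rV_d, (forall i, 0 <= w 0 i) -> \sum_i w 0 i <= 1 -> P (v + w *m E) &
    forall p, P p -> exists2 c : 'rV_d, (forall i, `|c 0 i| <= 1) & p = v + c *m E].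
Proof.
case/polytope_rows=> N [S ->] /full_dimensional_rows[i0].
set D := \matrix_i _ => fullD; have [f E_unit coord_le1] := max_minor fullD.
set E := rowsub f D in E_unit coord_le1.
have rowD i : row i D = row i S - row i0 S by rewrite rowK.
exists (row i0 S), E; split=> //; first exact: convex_hull_rows.
  move=> w w_ge0 w_le1.
  exists ((1 - \sum_i w 0 i) *: delta_mx 0 i0 + \sum_i w 0 i *: delta_mx 0 (f i)).
    split=> [i|].
      rewrite mxE summxE mxE addr_ge0 ?mulr_ge0 ?subr_ge0 ?mxE ?ler0n //.
      by apply: sumr_ge0 => j _; rewrite !mxE mulr_ge0 ?ler0n.
    have delta1 (j : 'I_N) : \sum_i (delta_mx 0 j : 'rV[R]_N) 0 i = 1.
      rewrite (bigD1 j) //= big1 ?addr0 ?mxE ?eqxx // => i ij.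
      by rewrite mxE eqxx (negbTE ij).
    under eq_bigr do rewrite mxE summxE mxE.
    rewrite big_split -mulr_sumr delta1 mulr1 exchange_big /=.
    under [X in _ + X]eq_bigr => i _.
      under eq_bigr do rewrite mxE.
      by rewrite -mulr_sumr delta1 mulr1; over.
    by rewrite subrK.
  have -> : w *m E = \sum_i w 0 i *: row (f i) S - (\sum_i w 0 i) *: row i0 S.
    rewrite mulmx_sum_row scaler_suml -sumrB; apply: eq_bigr => i _.
    by rewrite row_rowsub rowD scalerBr.
  rewrite mulmxDl -scalemxAl -rowE mulmx_suml.
  rewrite scalerBl scale1r [RHS]addrAC -addrA; congr (_ + (_ - _)).
  by apply: eq_bigr => i _; rewrite -scalemxAl -rowE.
move=> _ [c [c_ge0 c1] ->]; exists (c *m (D *m invmx E)).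
  move=> i; rewrite mxE (le_trans (ler_norm_sum _ _ _)) // -[leRHS]c1.
  by apply: ler_sum => j _; rewrite normrM ger0_norm // ler_piMr.
rewrite -mulmxA mulmxKV // !mulmx_sum_row.
under [in RHS]eq_bigr do rewrite rowD scalerBr.
by rewrite sumrB -scaler_suml c1 scale1r addrC subrK.
Qed.

(** Packaged as a linear functional into R^o, as the width requires. *)
Definition dot_with (u x : 'rV[R]_d) : R^o := dot x u.

Fact dot_with_linear u : linear (dot_with u).
Proof. by move=> a x y; rewrite /dot_with dotDl dotZl. Qed.

HB.instance Definition _ u :=
  GRing.isLinear.Build R 'rV[R]_d R^o _ (dot_with u) (dot_with_linear u).

Lemma linear_bounded (v : 'rV[R]_d) (E : 'M[R]_d) (u : {linear 'rV[R]_d -> R^o})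
  (c : 'rV[R]_d) :
  (forall i, `|c 0 i| <= 1) ->
  `|u (v + c *m E) - u v| <= \sum_i `|u (row i E) : R|.
Proof.
move=> c_le1; rewrite linearD addrAC subrr add0r mulmx_sum_row linear_sum.
rewrite (le_trans (ler_norm_sum _ _ _)) // ler_sum // => i _.
by rewrite linearZ normrM ler_piMl.
Qed.

(** Widths along other functionals are nonnegative, so that the infimum defining
    the lattice width is bounded by the width along z. *)
Lemma lattice_width_le (P : set 'rV[R]_d) (v : 'rV[R]_d) (E : 'M[R]_d) (z : 'rV[int]_d) :
  P v -> (forall p, P p -> exists2 c : 'rV_d, (forall i, `|c 0 i| <= 1) & p = v + c *m E) ->
  z != 0 -> lattice_width P <= 2%:R * \sum_i `|dot (row i E) (imx z)|.
Proof.
move=> Pv P_sub z0.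
have u_bd (u : {linear 'rV[R]_d -> R^o}) :
    ubound (u @` P) (u v + \sum_i `|u (row i E) : R|) /\
    lbound (u @` P) (u v - \sum_i `|u (row i E) : R|).
  split=> _ [p /P_sub[c c_le1 ->] <-];
    by have := linear_bounded v E u c_le1; rewrite ler_norml => /andP[]; lra.
have u_P0 (u : 'rV[R]_d -> R) : u @` P !=set0 by exists (u v), v.
have width_ge0 (u : {linear 'rV[R]_d -> R^o}) : 0 <= width_along u P.
  have [ub lb] := u_bd u; rewrite subr_ge0.
  have vP : (u @` P) (u v) by exists v.
  by apply: le_trans (ge_inf _ vP) (ub_le_sup _ vP); eexists; [exact: lb | exact: ub].
pose u : {linear 'rV[R]_d -> R^o} := dot_with (imx z).
apply: (@le_trans _ _ (width_along u P)).
  apply: ge_inf; first by exists 0 => _ [u' [_ _ ->]].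
  exists u; split=> //.
    move=> x x_int; rewrite /u /= /dot_with dotE rpred_sum // => i _.
    by rewrite rpredM // mxE intr_int.
  exists (imx z); rewrite /u /= /dot_with gt_eqF // dot_gt0 //.
  apply: contraNneq z0 => /rowP zi; apply/eqP/rowP => i.
  by have /eqP := zi i; rewrite !mxE intr_eq0 => /eqP.
have [ub lb] := u_bd u.
have := ge_sup (u_P0 u) ub; have := lb_le_inf (u_P0 u) lb.
by rewrite /width_along /u /=; rewrite /dot_with; lra.
Qed.

(** In coordinates with respect to the edges E of the inscribed simplex, Z^d is
    the lattice spanned by the rows of E^-1, and its dual vectors list the
    values of an integral functional on the edges.  A width above 2 d K forces
    these to have length at least K, so the covering radius is at most 3^d / K.
    The value of K makes this b = 1 / (2 d M), the half side of a cube that fits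
    into the simplex shrunk by the factor M. *)
Lemma flatness (P : set 'rV[R]_d) (M : nat) : (0 < d)%N -> (0 < M)%N ->
  polytope P -> full_dimensional P ->
  4%:R * d%:R ^+ 2 * 3%:R ^+ d * M%:R < lattice_width P ->
  forall x : 'rV_d, exists2 p, P p & exists z : 'rV[int]_d, x = M%:R^-1 *: p + imx z.
Proof.
move=> d_gt0 M_gt0 polyP fullP wide x.
have [v [E [_ E_unit simplexP boxP]]] := simplex_sandwich polyP fullP.
have dR : 0 < d%:R :> R by rewrite ltr0n.
have MR : 0 < M%:R :> R by rewrite ltr0n.
have D3 : 0 < 3%:R ^+ d :> R by rewrite exprn_gt0.
have Pv : P v.
  have := simplexP 0; rewrite mul0mx addr0; apply=> [i|]; first by rewrite mxE.
  by rewrite big1 // => i _; rewrite mxE.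
pose K : R := 2%:R * d%:R * 3%:R ^+ d * M%:R.
have K_gt0 : 0 < K by rewrite !mulr_gt0.
have dual_ge f : (f <= invmx E)%MS -> f != 0 -> integral_on (invmx E) f -> K ^+ 2 <= dot f f.
  move=> _ f0 /int_rowP[z fz].
  have def_f : f = imx z *m E^T by rewrite -fz -mulmxA -trmx_mul mulmxV // trmx1 mulmx1.
  have z0 : z != 0.
    by apply: contraNneq f0 => z0; rewrite def_f z0 /imx map_mx0 mul0mx.
  have fE i : f 0 i = dot (row i E) (imx z).
    by rewrite dotC /dot def_f tr_row !mxE; apply: eq_bigr => j _; rewrite !mxE.
  rewrite leNgt; apply/negP => f_lt.
  suff : lattice_width P <= 2%:R * (d%:R * K).
    by rewrite /K; move: wide; lra.
  apply: le_trans (lattice_width_le Pv boxP z0) _; rewrite ler_pM2l //.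
  rewrite mulr_natl -[X in K *+ X]card_ord -sumr_const ler_sum // => i _.
  rewrite -fE -(ler_pXn2r (n := 2)) ?nnegrE ?(ltW K_gt0) // real_normK ?num_real //.
  exact: le_trans (coord_le_dot f i) (ltW f_lt).
pose b : R := (2%:R * d%:R * M%:R)^-1.
have b_gt0 : 0 < b by rewrite invr_gt0 !mulr_gt0.
(* the cube [0, 2 b]^d is centred at the constant vector b *)
pose y := (x - M%:R^-1 *: v) *m invmx E - const_mx b.
have [|||z] := @covering _ _ _ (invmx E) (K ^+ 2) _ _ dual_ge y.
- by rewrite exprn_gt0.
- by rewrite row_free_unit unitmx_inv.
- by apply/submxP; exists (y *m E); rewrite mulmxK.
set r := y - _ => r_small.
have r_le i : `|r 0 i| <= b.
  rewrite -(ler_pXn2r (n := 2)) ?nnegrE ?(ltW b_gt0) // real_normK ?num_real //.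
  apply: le_trans (coord_le_dot r i) (le_trans r_small _).
  have -> : 9%:R = 3%:R ^+ 2 :> R by rewrite expr2 -natrM.
  rewrite exprAC -exprVn -exprMn; suff -> : 3%:R ^+ d / K = b by [].
  by rewrite /K /b; field; rewrite !gt_eqF.
pose w := M%:R *: (r + const_mx b).
have wE : x = M%:R^-1 *: (v + w *m E) + imx z.
  have -> : w *m E = M%:R *: (x - M%:R^-1 *: v - imx z).
    rewrite /w /r /y addrAC subrK -mulmxBl -scalemxAl mulmxKV //.
  by rewrite scalerDr scalerA mulVf ?gt_eqF // scale1r -addrA subrK addrC subrK.
clearbody r; exists (v + w *m E); last by exists z.
apply: simplexP => [i|].
  by rewrite !mxE mulr_ge0 //; have := r_le i; rewrite ler_norml => /andP[]; lra.
apply: (@le_trans _ _ (\sum_(i < d) d%:R^-1)); last first.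
  by rewrite sumr_const card_ord -[leLHS]mulr_natl mulfV ?gt_eqF.
apply: ler_sum => i _; rewrite !mxE.
have rb : r 0 i + b <= 2%:R * b by have := r_le i; rewrite ler_norml => /andP[]; lra.
have -> : d%:R^-1 = M%:R * (2%:R * b) :> R by rewrite /b; field; rewrite !gt_eqF.
by rewrite ler_pM2l.
Qed.

End Geometry.

(** * Lattice points in translates and dilates *)

Lemma card_fset_partition (T : choiceType) (I : finType) (A : {fset T}) (h : T -> I) :
  #|` A| = (\sum_i #|` [fset x in A | h x == i]|)%fset%N.
Proof.
rewrite card_fset_sum1 (partition_big h xpredT) //=; apply: eq_bigr => i _.
by rewrite big_fset_condE card_fset_sum1.
Qed.

Lemma card_image_inj (T U : choiceType) (A : {fset T}) (f : T -> U) :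
  injective f -> #|` (f @` A)%fset| = #|` A|.
Proof. by move=> f_inj; rewrite card_imfset. Qed.

Lemma leq_card_fset_set_inj (T : choiceType) (X Y : set T) (f : T -> T) :
  finite_set X -> finite_set Y -> injective f -> (forall x, X x -> Y (f x)) ->
  (#|` fset_set X| <= #|` fset_set Y|)%N.
Proof.
move=> finX finY f_inj XY; rewrite -(card_image_inj _ f_inj) /=.
apply/fsubset_leq_card/fsubsetP => _ /imfsetP[x /= xX ->].
by move: xX; rewrite !in_fset_set // !inE; apply: XY.
Qed.

Lemma finite_int_box d (B : nat) : finite_set [set z : 'rV[int]_d | forall i, `|z 0 i| <= B%:Z].
Proof.
pose f (g : {ffun 'I_d -> 'I_(B + B).+1}) : 'rV[int]_d := \row_i ((g i)%:Z - B%:Z).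
apply: (@sub_finite_set _ _ (f @` setT)); last exact/finite_image/finite_finset.
move=> z zB; exists [ffun i => inord (absz (z 0 i + B%:Z))] => //.
apply/rowP => i; rewrite mxE ffunE; have := zB i => /= zi.
rewrite inordK; lia.
Qed.

Section Counting.
Context {R : realType} {d : nat}.
Implicit Types (P X Y : set 'rV[R]_d) (c : 'rV[R]_d) (t : R).

Definition int_points X : set 'rV[int]_d := [set z | X (imx z)].
Definition npoints X : nat := #|` fset_set (int_points X)|.

Definition homothet P t c : set 'rV[R]_d := [set t *: p + c | p in P].

Definition bounded_coords P := exists b : R, forall p, P p -> forall i, `|p 0 i| <= b.

Lemma finite_int_points P t c : bounded_coords P -> finite_set (int_points (homothet P t c)).
Proof.
case=> b Pb; pose e := `|t| * b + \sum_i `|c 0 i|.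
have [B eB] : exists B : nat, e <= B%:R.
  by exists (Num.truncn e).+1; rewrite ltW // truncnS_gt.
apply: sub_finite_set (finite_int_box d B) => z [p Pp tpc] i.
rewrite -(ler_int R) intr_norm; apply: le_trans eB.
have <- : (imx z) 0 i = (z 0 i)%:~R :> R by rewrite mxE.
rewrite -tpc !mxE (le_trans (ler_normD _ _)) // lerD //.
  by rewrite normrM ler_wpM2l // Pb.
by rewrite (bigD1 i) //= lerDl sumr_ge0.
Qed.

Lemma ehrhartE P n : bounded_coords P -> ehrhart P n = npoints (homothet P n%:R 0).
Proof.
move=> bP; rewrite /ehrhart /npoints.
have fin := finite_int_points n%:R 0 bP.
have imx_inj : injective (@imx R 1 d).
  by move=> y z /rowP yz; apply/rowP => i; have := yz i; rewrite !mxE => /intr_inj.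
rewrite -(card_image_inj _ imx_inj); congr (#|` _|).
have -> : dilate n P `&` lattice_points = [set imx z | z in int_points (homothet P n%:R 0)].
  apply/seteqP; split=> [x [[p Pp <-] x_int]|_ [z [p Pp pz] <-]].
    have [z xz] : exists z, n%:R *: p = imx z by apply/int_rowP/forallP.
    by exists z => //; exists p => //; rewrite addr0.
  split; first by exists p; rewrite // -pz addr0.
  by move=> i; rewrite mxE intr_int.
rewrite fset_set_image //.
Qed.

Definition residue p (z : 'rV[int]_d) : {ffun 'I_d -> 'I_p.+1} :=
  [ffun i => inord (absz (modz (z 0 i) p.+1))].
Definition residue_row p (r : {ffun 'I_d -> 'I_p.+1}) : 'rV[int]_d := \row_i (r i)%:Z.

(** The points z = p q + r with a given residue r correspond to the points q of
    the homothet scaled down by p and translated accordingly. *)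
Lemma npoints_residues P t c p : bounded_coords P ->
  npoints (homothet P (p.+1%:R * t) c) =
  \sum_(r : {ffun 'I_d -> 'I_p.+1})
     npoints (homothet P t (p.+1%:R^-1 *: (c - imx (residue_row r)))).
Proof.
move=> bP; rewrite {1}/npoints (card_fset_partition _ (@residue p)).
apply: eq_bigr => r _; rewrite /npoints.
have p0 : p.+1%:R != 0 :> R by rewrite pnatr_eq0.
pose f (q : 'rV[int]_d) := p.+1%:Z *: q + residue_row r.
have f_inj : injective f.
  move=> x y /addIr/rowP xy; apply/rowP => i; have := xy i; rewrite !mxE.
  by apply: mulfI.
rewrite -[RHS](card_image_inj _ f_inj); congr (#|` _|); apply/fsetP => z.
have finite_t := finite_int_points _ _ bP.
have in_f q : homothet P (p.+1%:R * t) c (imx (f q)) <->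
    homothet P t (p.+1%:R^-1 *: (c - imx (residue_row r))) (imx q).
  have -> : imx (f q) = p.+1%:R *: imx q + imx (residue_row r) :> 'rV[R]_d.
    by apply/rowP => i; rewrite !mxE rmorphD rmorphM.
  split=> -[x Px E]; exists x => //.
    apply: (scalerI p0); rewrite scalerDr !scalerA mulfV // scale1r.
    by rewrite addrA E addrK.
  by rewrite -E scalerDr !scalerA mulfV // scale1r addrA subrK.
rewrite in_fset /= [LHS]inE /= in_fset_set ?inE; last exact: finite_int_points.
apply/andP/imfsetP => [[/= zX /eqP rz]|[q /= + ->]].
  have def_z : z = f (\row_i divz (z 0 i) p.+1).
    apply/rowP => i; rewrite !mxE {1}(divz_eq (z 0 i) p.+1) mulrC; congr (_ + _).
    rewrite -rz ffunE inordK ?gez0_abs ?modz_ge0 //.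
    by rewrite -ltz_nat gez0_abs ?modz_ge0 // ltz_pmod.
  exists (\row_i divz (z 0 i) p.+1) => //=.
  rewrite in_fset_set //; apply/mem_set/in_f; rewrite -def_z; exact: set_mem zX.
rewrite in_fset_set // => /set_mem/in_f fq; split; first exact: mem_set.
apply/eqP/ffunP => i; apply/val_inj; rewrite ffunE !mxE /=.
by rewrite [p.+1%:Z * _]mulrC modzMDl modz_small ?ltz_nat ?ltn_ord //= inordK.
Qed.

Section Growth.
Context (P : set 'rV[R]_d) (M : nat).
Context (convP : convex_set P) (bP : bounded_coords P) (M_gt0 : (0 < M)%N).
Context (covers : forall x : 'rV_d, exists2 p, P p &
  exists z : 'rV[int]_d, x = M%:R^-1 *: p + imx z).

Let N m c := npoints (homothet P (m%:R / M%:R) c).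

(** By the covering, c' - c is an integer vector plus a point of P / M, and
    adding a point of P / M to (m/M) P stays within ((m+1)/M) P. *)
Lemma npoints_shift m c c' : (N m c' <= N m.+1 c)%N.
Proof.
have [p Pp [z cz]] := covers (c' - c).
have M0 : M%:R != 0 :> R by rewrite pnatr_eq0 -lt0n.
have m0 : m.+1%:R != 0 :> R by rewrite pnatr_eq0.
apply: (leq_card_fset_set_inj (f := fun y => y - z)).
- exact: finite_int_points.
- exact: finite_int_points.
- by move=> x y /addIr.
move=> y [q Pq yq]; pose t : R := m%:R / m.+1%:R.
exists (t *: q + (1 - t) *: p).
  apply: convP => //; rewrite divr_ge0 //= ler_pdivrMr ?ltr0n // mul1r ler_nat //.
have -> : imx (y - z) = imx y - imx z :> 'rV[R]_d.
  by apply/rowP => i; rewrite !mxE rmorphB.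
have -> : imx z = c' - c - M%:R^-1 *: p :> 'rV[R]_d by rewrite cz addrAC subrr add0r.
rewrite -yq; apply/rowP => i; rewrite !mxE /t -natr1; field.
by rewrite M0 natr1 m0.
Qed.

Lemma npointsM p m c : N (p.+1 * m)%N c =
  \sum_(r : {ffun 'I_d -> 'I_p.+1}) N m (p.+1%:R^-1 *: (c - imx (residue_row r))).
Proof. by rewrite /N natrM -mulrA; apply: npoints_residues. Qed.

Lemma sum_residues_const p k :
  (\sum_(r : {ffun 'I_d -> 'I_p.+1}) k = p.+1 ^ d * k)%N.
Proof. by rewrite sum_nat_const card_ffun !card_ord. Qed.

Lemma npointsM_ge p m c k :
  (forall c', (k <= N m c')%N) -> (p.+1 ^ d * k <= N (p.+1 * m)%N c)%N.
Proof. by move=> k_le; rewrite npointsM -sum_residues_const; apply: leq_sum. Qed.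

Lemma npointsM_le p m c k :
  (forall c', (N m c' <= k)%N) -> (N (p.+1 * m)%N c <= p.+1 ^ d * k)%N.
Proof. by move=> k_ge; rewrite npointsM -sum_residues_const; apply: leq_sum. Qed.

(** Both sides are compared with the number of points of ((M-1)(M+1)/M) P,
    split into residues modulo M + 1 and modulo M - 1 respectively. *)
Lemma npoints_translates c c' : (1 < M)%N -> (M.-1 ^ d * N M c' <= M.+1 ^ d * N M c)%N.
Proof.
case: M M_gt0 @N npoints_shift npointsM_ge npointsM_le => [//|[//|m]] _ N0 shift ge_N le_N _.
apply: (@leq_trans (N0 (m.+1 * m.+3)%N 0)).
  by apply: ge_N => c0; apply: shift.
by rewrite mulnC; apply: le_N => c0; apply: shift.
Qed.

Lemma ehrhart_npoints n : ehrhart P n = N (n * M)%N 0.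
Proof. by rewrite ehrhartE // /N natrM mulfK // pnatr_eq0 -lt0n. Qed.

Lemma ehrhart0 : ehrhart P 0 = 1%N.
Proof.
have [p Pp _] := covers 0.
rewrite ehrhartE // /npoints (_ : int_points _ = [set 0]) ?fset_set1 ?cardfs1 //.
apply/seteqP; split=> z.
  case=> q _ qz; apply/rowP => i; have /rowP/(_ i) := qz.
  by rewrite !mxE mul0r add0r => /esym/eqP; rewrite intr_eq0 => /eqP.
move=> ->; exists p => //; apply/rowP => i; rewrite !mxE mul0r add0r //.
Qed.

(** P splits into M^d homothets of ratio 1/M, each of which meets Z^d. *)
Lemma ehrhart1_ge : (M ^ d <= ehrhart P 1)%N.
Proof.
rewrite ehrhart_npoints mul1n -[X in N X]muln1 -[X in (X <= _)%N]muln1 -(prednK M_gt0).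
apply: npointsM_ge => c; apply: leq_trans (npoints_shift 0 c 0).
by have := ehrhart_npoints 0; rewrite ehrhart0 mul0n => <-.
Qed.

(** The points of nP, sorted by residues modulo n, are those of n^d translates
    of P. *)
Lemma ehrhart_ratio n : (1 < M)%N -> (0 < n)%N ->
  (M.-1 ^ d * (n ^ d * ehrhart P 1) <= M.+1 ^ d * ehrhart P n)%N /\
  (M.-1 ^ d * ehrhart P n <= M.+1 ^ d * (n ^ d * ehrhart P 1))%N.
Proof.
case: n => // n M_gt1 _; rewrite !ehrhart_npoints mul1n npointsM.
rewrite -!(sum_residues_const n) !big_distrr /=; split; apply: leq_sum => r _;
  exact: npoints_translates.
Qed.

End Growth.

End Counting.

(** * Convergence to the Eulerian polynomial *)

Section Limit.
Context {R : realType}.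

Lemma polytope_bounded d (P : set 'rV[R]_d) :
  polytope P -> full_dimensional P -> bounded_coords P.
Proof.
move=> polyP fullP; have [v [E [_ _ _ boxP]]] := simplex_sandwich polyP fullP.
exists (\sum_i `|v 0 i| + \sum_i \sum_j `|E j i|) => p /boxP[c c_le1 ->] i.
rewrite !mxE (le_trans (ler_normD _ _)) // lerD //.
  by rewrite (bigD1 i) //= lerDl sumr_ge0.
rewrite (le_trans (ler_norm_sum _ _ _)) // [leRHS](bigD1 i) //= ler_wpDr //.
  by apply: sumr_ge0 => k _; apply: sumr_ge0.
by apply: ler_sum => k _; rewrite normrM ler_piMl.
Qed.

Lemma eulerian_coef d j : (eulerian d : {poly R})`_j =
  \sum_(i < j.+1) i%:R ^+ d * ((1 - 'X) ^+ d.+1 : {poly R})`_(j - i).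
Proof.
have [r] := @eulerian_series R d j.+1.
move/(congr1 (fun p : {poly R} => p`_j)).
rewrite coefD coefXnM ltnSn addr0 coefM => <-.
by apply: eq_bigr => i _; rewrite coef_poly ltn_ord.
Qed.

Lemma bernoulli_ineq (t : R) n : 0 <= t <= 1 -> 1 - n%:R * t <= (1 - t) ^+ n.
Proof.
case/andP=> t_ge0 t_le1; elim: n => [|n IH]; first by rewrite mul0r subr0.
have : 0 <= n%:R :> R by rewrite ler0n.
rewrite exprS -natr1; have : 0 <= 1 - t by rewrite subr_ge0.
move=> t1 n0; have := ler_wpM2l t1 IH; nra.
Qed.

(** With 1 - t = (M - 1) / (M + 1), Bernoulli's inequality shows that the ratio
    of the factors (M - 1)^d and (M + 1)^d tends to 1. *)
Lemma power_ratio_close d (eta : R) : 0 < eta ->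
  exists2 M : nat, (1 < M)%N & eta^-1 <= M%:R /\
  forall n (x : R), (n <= d)%N ->
    M.-1%:R ^+ d * n%:R ^+ d <= M.+1%:R ^+ d * x ->
    M.-1%:R ^+ d * x <= M.+1%:R ^+ d * n%:R ^+ d -> `|x - n%:R ^+ d| <= eta.
Proof.
move=> eta_gt0; pose D : R := d%:R ^+ d.
have D_ge0 : 0 <= D by rewrite exprn_ge0.
pose b : R := eta^-1 + 4%:R * d%:R * (1 + D / eta) + 1.
have inv_gt0 : 0 < eta^-1 by rewrite invr_gt0.
have dR : 0 <= d%:R :> R by rewrite ler0n.
have dD : 0 <= d%:R * (1 + D / eta) by rewrite mulr_ge0 // addr_ge0 // mulr_ge0 // ltW.
exists (Num.truncn b).+2 => //; set M := (Num.truncn b).+2.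
have M_gt : b < M%:R.
  by apply: lt_trans (truncnS_gt b) _; rewrite ltr_nat.
split; first by move: M_gt; rewrite /b; lra.
move=> n x nd lo hi.
have S_gt0 : 0 < M.+1%:R :> R by rewrite ltr0n.
pose t : R := 2%:R / M.+1%:R.
have t_ge0 : 0 <= t by rewrite divr_ge0 // ltW.
have tE : M.-1%:R = M.+1%:R * (1 - t) :> R.
  rewrite /t mulrBr mulr1 mulrCA mulfV ?gt_eqF // mulr1.
  by rewrite /M /= -[in RHS]addn2 natrD addrK.
have t_le : 4%:R * d%:R * (1 + D / eta) * t <= 2%:R.
  rewrite /t mulrA ler_pdivrMr // -natr1; move: M_gt; rewrite /b; lra.
have t_le1 : t <= 1 by rewrite ler_pdivrMr // mul1r ler_nat.
have := @bernoulli_ineq t d; rewrite t_ge0 t_le1 => /(_ isT).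
set theta := (1 - t) ^+ d => bern.
have Sd : 0 < M.+1%:R ^+ d :> R by rewrite exprn_gt0.
move: lo hi; rewrite tE exprMn -!mulrA !ler_pM2l // -/theta => lo hi.
have nD : n%:R ^+ d <= D by rewrite lerXn2r ?nnegrE ?ler0n // ler_nat.
have n_ge0 : 0 <= n%:R ^+ d :> R by rewrite exprn_ge0.
pose s := d%:R * t; have s_ge0 : 0 <= s by rewrite mulr_ge0.
have De_ge0 : 0 <= D / eta by rewrite mulr_ge0 // ltW.
have s_le : 2%:R * (s * (1 + D / eta)) <= 1 by rewrite /s; lra.
have s_half : 2%:R * s <= 1 by nra.
have s_eta : 2%:R * (s * D) <= eta.
  have : 2%:R * (s * (1 + D / eta)) * eta <= eta by rewrite -[leRHS]mul1r ler_pM2r.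
  have -> : 2%:R * (s * (1 + D / eta)) * eta = 2%:R * (s * eta) + 2%:R * (s * D).
    by field; rewrite gt_eqF.
  have := mulr_ge0 s_ge0 (ltW eta_gt0); lra.
rewrite -/s in bern; move: (n%:R ^+ d) nD n_ge0 lo hi => y yD y_ge0 lo hi.
have ys := ler_wpM2r y_ge0 bern.
have x_ge0 : 0 <= x by nra.
have xs := ler_wpM2r x_ge0 bern.
have sy : s * y <= s * D by apply: ler_wpM2l.
have x2y : x <= 2%:R * y by nra.
have sx : s * x <= s * (2%:R * y) by apply: ler_wpM2l.
by rewrite ler_norml; apply/andP; split; nra.
Qed.

(** h* and the Eulerian polynomial depend linearly, and in the same way, on the
    initial values of the series L(n) and n^d. *)
Lemma hstar_coef_bound d (P : set 'rV[R]_d) h (L eta : R) : is_hstar P h ->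
  0 < L -> (forall i, (i <= d)%N -> `|(ehrhart P i)%:R / L - i%:R ^+ d| <= eta) ->
  forall j, (j <= d)%N -> `|(L^-1 *: h)`_j - (eulerian d : {poly R})`_j| <=
    \sum_(k < d.+1) eta * \sum_(k < d.+1) `|((1 - 'X) ^+ d.+1 : {poly R})`_k|.
Proof.
move=> [_ series] L_gt0 close j jd; rewrite coefZ -[h`_j]series eulerian_coef.
rewrite mulr_sumr -sumrB (le_trans (ler_norm_sum _ _ _)) //.
have eta_ge0 : 0 <= eta by apply: le_trans (close 0%N _).
rewrite (big_ord_widen d.+1 (fun i => `|L^-1 * (ehrhart_series P i *
  fps_poly ((1 - 'X) ^+ d.+1) (j - i)%N) - i%:R ^+ d * ((1 - 'X) ^+ d.+1)`_(j - i)|)) //.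
rewrite big_mkcond; apply: ler_sum => i _.
have sum_ge0 : 0 <= \sum_(k < d.+1) `|((1 - 'X) ^+ d.+1 : {poly R})`_k| by apply: sumr_ge0.
case: ifP => _; last by rewrite mulr_ge0.
rewrite /fps_poly mulrA -mulrBl normrM ler_pM //.
  by rewrite mulrC close // -ltnS.
have ji : (j - i < d.+1)%N by rewrite ltnS (leq_trans (leq_subr _ _)).
by rewrite (bigD1 (Ordinal ji)) //= lerDl sumr_ge0.
Qed.

End Limit.

Theorem theorem1p1 (R : realType) (d : nat) (hd : (1 <= d)%N) :
  exists2 C : R, 0 < C &
    forall P : set 'rV[R]_d, lattice_polytope P -> C < lattice_width P ->
    forall h : {poly R}, is_hstar P h ->
      (forall j : nat, (j <= d)%N -> 0 < h`_j) /\
      (exists s : seq R,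
         [/\ size s = d, uniq s & forall x, x \in s -> x < 0 /\ root h x]).
Proof.
(* d, and with it the tolerance e, is fixed before M, which in turn is fixed
   before P *)
case: d hd => // d _; have [e e_gt0 near_e] := @near_eulerian R d.
pose K : R := 1 + \sum_(k < d.+2) `|((1 - 'X) ^+ d.+2 : {poly R})`_k|.
have K_ge0 : 0 <= \sum_(k < d.+2) `|((1 - 'X) ^+ d.+2 : {poly R})`_k| by apply: sumr_ge0.
have K_gt0 : 0 < K by rewrite ltr_pwDl.
pose eta := e / (d.+2%:R * K).
have dK_gt0 : 0 < d.+2%:R * K by rewrite mulr_gt0 ?ltr0n.
have eta_gt0 : 0 < eta by rewrite divr_gt0.
have [M M_gt1 [M_ge close_M]] := power_ratio_close d.+1 eta_gt0.
have M_gt0 := ltnW M_gt1.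
exists (4%:R * d.+1%:R ^+ 2 * 3%:R ^+ d.+1 * M%:R).
  by rewrite !mulr_gt0 ?exprn_gt0 ?ltr0n.
move=> P [polyP fullP _] wide h hstar.
have covers := flatness (ltn0Sn d) M_gt0 polyP fullP wide.
have boundedP := polytope_bounded polyP fullP.
have [_ [_ [convP _ _ _]]] := simplex_sandwich polyP fullP.
have L0 := ehrhart0 boundedP covers.
have L1_ge : (M <= ehrhart P 1)%N.
  apply: leq_trans (ehrhart1_ge convP boundedP M_gt0 covers).
  by rewrite -[X in (X <= _)%N]expn1 leq_pexp2l.
pose L : R := (ehrhart P 1)%:R.
have L_gt0 : 0 < L by rewrite ltr0n (leq_trans M_gt0).
have close i : (i <= d.+1)%N -> `|(ehrhart P i)%:R / L - i%:R ^+ d.+1| <= eta.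
  case: i => [_|i id1].
    rewrite L0 expr0n subr0 mul1r gtr0_norm ?invr_gt0 // invf_ple ?posrE //.
    by rewrite (le_trans M_ge) // ler_nat.
  have [lo hi] := ehrhart_ratio convP boundedP M_gt0 covers M_gt1 (ltn0Sn i).
  apply: close_M => //.
    rewrite mulrA ler_pdivlMr // -!natrX -!natrM ler_nat -mulnA //.
  rewrite mulrA ler_pdivrMr // -!natrX -!natrM ler_nat -mulnA //.
have close_coef := hstar_coef_bound hstar L_gt0 close.
have [sz_h series] := hstar.
have [|||q_gt0 [s [sz_s uniq_s roots_s]]] := near_e (L^-1 *: h).
- exact: leq_trans (size_scale_leq _ _) sz_h.
- rewrite coefZ mulr_gt0 ?invr_gt0 // -[h`_0]series /fps_mul big_ord1.
  rewrite /ehrhart_series L0 mul1r /fps_poly -horner_coef0 horner_exp.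
  by rewrite hornerD hornerN hornerX hornerC oppr0 addr0 expr1n.
- move=> j jd; apply: le_trans (close_coef j jd) _.
  rewrite sumr_const card_ord -mulr_natl.
  have <- : d.+2%:R * (eta * K) = e by rewrite mulrCA divfK ?gt_eqF.
  by rewrite ler_pM2l ?ltr0n // ler_pM2l // lerDr.
split=> [j jd|].
  by have := q_gt0 j jd; rewrite coefZ pmulr_rgt0 // invr_gt0.
exists s; split=> // x xs; have [x_lt0 qx] := roots_s x xs; split=> //.
by move: qx; rewrite rootZ // invr_eq0 gt_eqF.
Qed.
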